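(* Let $S = \langle s_1, \ldots, s_n \rangle$ ($n \geq 1$) be a finite sequence of policy values in $V_6$. Then $$\delta\Bigl(\bigoplus\nolimits_{\mathbf{o\text{-}1\text{-}a}}^{V_6}(S)\Bigr) = \bigoplus\nolimits_{\mathbf{o\text{-}1\text{-}a}}^{\mathbf{P}}(\delta(S)).$$ That is, the only-one-applicable combining algorithm under $V_6$ and the only-one-applicable combining algorithm under $\mathbf{P}$ agree via $\delta$.
   Context: $V_6 = \{\top_{\mathbf{p}}, \top_{\mathbf{d}}, I_{\mathbf{d}}, I_{\mathbf{p}}, I_{\mathbf{dp}}, \bot\}$ is a set of six distinct values. The set of pairwise policy values is $\mathbf{P} = \{[0,0], [\frac12,0], [0,\frac12], [\frac12,\frac12], [1,0], [0,1]\}$; for a pair write $d([D,P]) = D$ and $p([D,P]) = P$. The map $\delta : V_6 \to \mathbf{P}$ is: $\delta(\bot) = [0,0]$, $\delta(I_{\mathbf{d}}) = [\frac12,0]$, $\delta(I_{\mathbf{p}}) = [0,\frac12]$, $\delta(I_{\mathbf{dp}}) = [\frac12,\frac12]$, $\delta(\top_{\mathbf{d}}) = [1,0]$, $\delta(\top_{\mathbf{p}}) = [0,1]$. On sequences $\delta$ is applied elementwise: $\delta(\langle s_1,\dots,s_n\rangle) = \langle \delta(s_1), \dots, \delta(s_n)\rangle$. For a set $X$ of pairs, $\mathit{Max}(X) = [\max\{d(x) \mid x \in X\}, \max\{p(x) \mid x \in X\}]$, the componentwise maximum (a pair in $\{0,\frac12,1\}^2$). Only-one-applicable under $V_6$.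 Let $\sqsubseteq_{\mathbf{o\text{-}1\text{-}a}}$ be the lattice order on $V_6$ whose covering relations are: $\bot < \top_{\mathbf{d}}$, $\top_{\mathbf{d}} < I_{\mathbf{d}}$, $I_{\mathbf{d}} < I_{\mathbf{dp}}$, $\bot < \top_{\mathbf{p}}$, $\top_{\mathbf{p}} < I_{\mathbf{p}}$, $I_{\mathbf{p}} < I_{\mathbf{dp}}$; write $\bigsqcup_{\mathbf{o\text{-}1\text{-}a}}$ for its least upper bound. For a sequence $S = \langle s_1, \ldots, s_n\rangle$ in $V_6$ with $S' = \{s_1, \ldots, s_n\}$, $$\bigoplus\nolimits_{\mathbf{o\text{-}1\text{-}a}}^{V_6}(S) = \begin{cases} I_{\mathbf{d}} & \text{if } \exists i \neq j : s_i = s_j = \top_{\mathbf{d}} \text{ and } \forall k : (s_k \neq \top_{\mathbf{d}} \Rightarrow s_k = \bot), \\ I_{\mathbf{p}} & \text{if } \exists i \neq j : s_i = s_j = \top_{\mathbf{p}} \text{ and } \forall k : (s_k \neq \top_{\mathbf{p}} \Rightarrow s_k = \bot), \\ \bigsqcup_{\mathbf{o\text{-}1\text{-}a}} S' & \text{otherwise.} \end{cases}$$ Only-one-applicable under $\mathbf{P}$. For a sequence $S = \langle s_1, \ldots, s_n\rangle$ in $\mathbf{P}$ with $S' = \{s_1, \ldots, s_n\}$, $$\bigoplus\nolimits_{\mathbf{o\text{-}1\text{-}a}}^{\mathbf{P}}(S) = \begin{cases} [\frac12,\frac12] & \text{if } \mathit{Max}(S') = [D,P] \text{ with } D, P \geq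 \frac12, \\ [\frac12,0] & \text{if } \mathit{Max}(S') = [D,0] \text{ with } D \geq \frac12 \text{ and } \exists i \neq j : d(s_i), d(s_j) \geq \frac12, \\ [0,\frac12] & \text{if } \mathit{Max}(S') = [0,P] \text{ with } P \geq \frac12 \text{ and } \exists i \neq j : p(s_i), p(s_j) \geq \frac12, \\ \mathit{Max}(S') & \text{otherwise.} \end{cases}$$ Here $i, j, k$ range over the positions $1, \ldots, n$ of the sequence. *)

(* Defs.v *)
From HB Require Import structures.
From mathcomp Require Import all_boot all_order all_algebra.

Set Implicit Arguments.
Unset Strict Implicit.
Unset Printing Implicit Defensive.

Import Order.TTheory GRing.Theory Num.Theory.

Variant V6 : predArgType := TopP | TopD | ID | IP | IDP | Bot.

Definition V6_code (x : V6) : nat :=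
  match x with
  | TopP => 0 | TopD => 1 | ID => 2 | IP => 3 | IDP => 4 | Bot => 5
  end.

Definition V6_decode (k : nat) : V6 :=
  nth Bot [:: TopP; TopD; ID; IP; IDP; Bot] k.

Lemma V6_codeK : cancel V6_code V6_decode.
Proof. by case. Qed.

HB.instance Definition _ := Countable.copy V6 (can_type V6_codeK).

Lemma V6_enumP : Finite.axiom [:: TopP; TopD; ID; IP; IDP; Bot].
Proof. by case. Qed.

HB.instance Definition _ := isFinite.Build V6 V6_enumP.

(* [o1a_cover x y]: y covers x in the only-one-applicable lattice. *)
Definition o1a_cover : rel V6 := fun x y =>
  match x, y with
  | Bot, TopD | TopD, ID | ID, IDP
  | Bot, TopP | TopP, IP | IP, IDP => true
  | _, _ => false
  end.

(* A finite order is the reflexive transitive closure of its covering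
   relation. *)
Definition o1a_le : rel V6 := connect o1a_cover.

Lemma o1a_leE x y :
  o1a_le x y = [|| x == y, x == Bot, y == IDP,
                   (x == TopD) && (y == ID) | (x == TopP) && (y == IP)].
Proof.
apply/idP/idP.
  case/connectP=> p; elim: p x => [|z p IHp] x /=; first by move=> _ ->; rewrite eqxx.
  case/andP=> xz /IHp{}IHp /IHp.
  by case: x xz => //; case: z {IHp} => //; case: y.
have c a b : o1a_cover a b -> connect o1a_cover a b by apply: connect1.
have bd : connect o1a_cover Bot ID by apply: (connect_trans (c _ TopD _)) (c _ _ _).
have bp : connect o1a_cover Bot IP by apply: (connect_trans (c _ TopP _)) (c _ _ _).
case: x; case: y => // _; rewrite /o1a_le; try exact: connect0; try exact: c.
- exact: (connect_trans (c _ IP _)) (c _ _ _).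
- exact: (connect_trans (c _ ID _)) (c _ _ _).
- exact: (connect_trans bd) (c _ _ _).
Qed.

Lemma o1a_le_refl : reflexive o1a_le.
Proof. exact: connect0. Qed.

Lemma o1a_le_anti : antisymmetric o1a_le.
Proof. by move=> x y; rewrite !o1a_leE; case: x; case: y. Qed.

Lemma o1a_le_trans : transitive o1a_le.
Proof. exact: connect_trans. Qed.

Definition o1a_meet (x y : V6) : V6 :=
  if o1a_le x y then x else if o1a_le y x then y else Bot.

Definition o1a_join (x y : V6) : V6 :=
  if o1a_le x y then y else if o1a_le y x then x else IDP.

Fact o1a_display : Order.disp_t. Proof. exact: Order.Disp tt tt. Qed.

HB.instance Definition _ := Order.Le_isPOrder.Build o1a_display V6
  o1a_le_refl o1a_le_anti o1a_le_trans.

Lemma o1a_meetP x y z :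
  (x <= o1a_meet y z)%O = (x <= y)%O && (x <= z)%O.
Proof.
rewrite /o1a_meet !/(_ <= _)%O /= !o1a_leE.
by case: x; case: y; case: z.
Qed.

Lemma o1a_joinP x y z :
  (o1a_join x y <= z)%O = (x <= z)%O && (y <= z)%O.
Proof.
rewrite /o1a_join !/(_ <= _)%O /= !o1a_leE.
by case: x; case: y; case: z.
Qed.

HB.instance Definition _ := Order.POrder_MeetJoin_isLattice.Build
  o1a_display V6 o1a_meetP o1a_joinP.

Lemma o1a_le0x x : (Bot <= x)%O.
Proof. by rewrite /(_ <= _)%O /= o1a_leE; case: x. Qed.

HB.instance Definition _ := Order.hasBottom.Build o1a_display V6 o1a_le0x.

Lemma o1a_coverP x y :
  reflect ((x < y)%O /\ forall z, ~ ((x < z)%O /\ (z < y)%O)) (o1a_cover x y).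
Proof.
have ltE a b : (a < b)%O = (b != a) && o1a_le a b by rewrite lt_def.
apply: (iffP idP) => [|[]].
  move=> xy; split=> [|z []]; move: xy; rewrite !ltE !o1a_leE.
    by case: x; case: y.
  by case: x; case: y => //; case: z.
rewrite ltE o1a_leE => xy no.
move: (no TopD) (no TopP) (no ID) (no IP); rewrite !ltE !o1a_leE.
case: x xy {no}; case: y => //= _ h1 h2 h3 h4;
  by [case: h1 | case: h2 | case: h3 | case: h4].
Qed.

(* The repetition conditions are about positions of S, whereas the least upper
   bound is taken over the set of entries. *)
Definition o1a_V6 (n : nat) (S : n.-tuple V6) : V6 :=
  if [exists i, exists j,
        [&& i != j, tnth S i == TopD & tnth S j == TopD]]
     && [forall k, (tnth S k != TopD) ==> (tnth S k == Bot)]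
  then ID
  else if [exists i, exists j,
             [&& i != j, tnth S i == TopP & tnth S j == TopP]]
          && [forall k, (tnth S k != TopP) ==> (tnth S k == Bot)]
  then IP
  else (\join_(x in [set x in S]) x)%O.

Local Open Scope ring_scope.

Definition policy_pairs : seq (rat * rat) :=
  [:: (0, 0); (1 / 2, 0); (0, 1 / 2); (1 / 2, 1 / 2); (1, 0); (0, 1)].

Definition PP : Type := seq_sub policy_pairs.
HB.instance Definition _ := Finite.on PP.

Definition d (x : PP) : rat := (val x).1.
Definition p (x : PP) : rat := (val x).2.

Definition delta_pair (x : V6) : rat * rat :=
  match x with
  | Bot  => (0, 0)
  | ID   => (1 / 2, 0)
  | IP   => (0, 1 / 2)
  | IDP  => (1 / 2, 1 / 2)
  | TopD => (1, 0)
  | TopP => (0, 1)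
  end.

Lemma delta_pair_subproof x : delta_pair x \in policy_pairs.
Proof. by case: x; rewrite !inE eqxx ?orbT. Qed.

Definition delta (x : V6) : PP := SeqSub (delta_pair_subproof x).

(* The components of elements of PP are nonnegative, so 0 is a neutral default
   for these maxima over nonempty X.  The result need not lie in PP
   (e.g. it can be (1, 1)). *)
Definition Max (X : {set PP}) : rat * rat :=
  (\big[Num.max/0]_(x in X) d x, \big[Num.max/0]_(x in X) p x).

Definition o1a_P (n : nat) (S : n.-tuple PP) : rat * rat :=
  let M := Max [set x in S] in
  if (1 / 2 <= M.1) && (1 / 2 <= M.2) then (1 / 2, 1 / 2)
  else if [&& 1 / 2 <= M.1, M.2 == 0 &
             [exists i, exists j,
                [&& i != j, 1 / 2 <= d (tnth S i) & 1 / 2 <= d (tnth S j)]]]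
  then (1 / 2, 0)
  else if [&& M.1 == 0, 1 / 2 <= M.2 &
             [exists i, exists j,
                [&& i != j, 1 / 2 <= p (tnth S i) & 1 / 2 <= p (tnth S j)]]]
  then (0, 1 / 2)
  else M.

(* Main.v *)
(** Both algorithms depend on the sequence only through the number of
    occurrences of each of the six values: "two distinct positions satisfy a"
    means that the count of a is at least 2.  Only the distinction between zero,
    one and several occurrences matters, so finitely many cases remain. *)
Require Import Defs.
From mathcomp Require Import all_boot all_order all_algebra.

Set Implicit Arguments.
Unset Strict Implicit.
Unset Printing Implicit Defensive.

Import Order.TTheory GRing.Theory Num.Theory.

Lemma exists2_tnthE (T : Type) (a : pred T) (n : nat) (S : n.-tuple T) :
  [exists i, exists j, [&& i != j, a (tnth S i) & a (tnth S j)]]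
    = (1 < count a S).
Proof.
have -> : count a S = #|[pred i | a (tnth S i)]|.
  by rewrite -{1}(map_tnth_enum S) count_map cardE enumT -size_filter.
apply/existsP/card_gt1P => [[i /existsP[j /and3P[ij ai aj]]]|[i [j [ai aj ij]]]].
  by exists i, j.
by exists i; apply/existsP; exists j; apply/and3P.
Qed.

Lemma forall_tnthE (T : Type) (a : pred T) (n : nat) (S : n.-tuple T) :
  [forall k, a (tnth S k)] = (count (predC a) S == 0).
Proof.
rewrite -leqn0 leqNgt -has_count has_predC negbK.
exact/forallP/all_tnthP.
Qed.

(** Reduces every count in the two algorithms to the multiplicities of the six single values. *)
Lemma count_sum (T : finType) (a : pred T) (s : seq T) :
  count a s = \sum_x a x * count_mem x s.
Proof.
elim: s => [|x s IHs] /=; first by rewrite big1 // => x _; rewrite muln0.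
under eq_bigr do rewrite mulnDr.
rewrite big_split /= -IHs (bigD1 x) //= eqxx muln1 big1 ?addn0 // => y.
by rewrite eq_sym => /negPf->; rewrite muln0.
Qed.

Lemma big_V6E (R : Type) (idx : R) (op : R -> R -> R) (F : V6 -> R) :
  \big[op/idx]_x F x =
  op (F TopP) (op (F TopD) (op (F ID) (op (F IP) (op (F IDP) (op (F Bot) idx))))).
Proof. by rewrite /index_enum [Finite.enum]unlock !big_cons big_nil. Qed.

Local Open Scope ring_scope.

(** As [g] may identify elements, this is no mere reindexing: each maximum bounds every term of the
    other. *)
Lemma bigmax_set_map (T U : finType) (g : T -> U) (f : U -> rat) (s : seq T) :
  \big[Num.max/0]_(y in [set y in map g s]) f y =
  \big[Num.max/0]_(x in [set x in s]) f (g x).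
Proof.
have ge0 (V : finType) (A : {set V}) (h : V -> rat) :
  0 <= \big[Num.max/0]_(x in A) h x by exact: bigmax_ge_id.
apply/le_anti/andP; split; apply: bigmax_le => // z; rewrite inE.
  case/mapP => x xs ->; apply: (le_bigmax_cond _ (fun x => f (g x))).
  by rewrite inE.
by move=> zs; apply: le_bigmax_cond; rewrite inE map_f.
Qed.

Lemma Max_deltaE (s : seq V6) :
  Max [set x in map delta s] =
  (if TopD \in s then 1 else if (ID \in s) || (IDP \in s) then 1 / 2 else 0,
   if TopP \in s then 1 else if (IP \in s) || (IDP \in s) then 1 / 2 else 0).
Proof.
(* Absent values contribute the default 0, so only membership of the six values matters. *)
rewrite /Max !bigmax_set_map; congr pair; rewrite bigmax_mkcond big_V6E !inE;
  by case: (TopP \in s) (TopD \in s) (ID \in s) (IP \in s) (IDP \in s) (Bot \in s)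
  => [] [] [] [] [] [].
Qed.

(** Without [IDP] and without a mix of the two sides, the entries lie on one chain, and the join is
    the greatest one present. *)
Lemma join_V6E (s : seq V6) :
  (\join_(x in [set x in s]) x)%O =
  if (IDP \in s) || ((TopD \in s) || (ID \in s)) && ((TopP \in s) || (IP \in s))
  then IDP
  else if ID \in s then ID else if IP \in s then IP
  else if TopD \in s then TopD else if TopP \in s then TopP else Bot.
Proof.
(* [o1a_le] is a [connect]; this boolean copy lets the joins evaluate by computation. *)
pose le x y := [|| x == y, x == Bot, y == IDP,
  (x == TopD) && (y == ID) | (x == TopP) && (y == IP)].
pose join x y := if le x y then y else if le y x then x else IDP.
have joinE x y : (x `|` y)%O = join x y.
  by rewrite /join /le -!o1a_leE.
rewrite big_mkcond big_V6E !inE /= !joinE.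
by do 6![case: (_ \in s)].
Qed.

Theorem proposition5 (n : nat) (hn : (0 < n)%N) (S : n.-tuple V6) :
  val (delta (o1a_V6 S)) = o1a_P [tuple of map delta S].
Proof.
rewrite /o1a_V6 /o1a_P Max_deltaE join_V6E.
rewrite (exists2_tnthE (pred1 TopD)) (exists2_tnthE (pred1 TopP)).
rewrite (exists2_tnthE (fun x => 1 / 2 <= d x)) (exists2_tnthE (fun x => 1 / 2 <= p x)).
rewrite (forall_tnthE (fun x => (x != TopD) ==> (x == Bot))).
rewrite (forall_tnthE (fun x => (x != TopP) ==> (x == Bot))).
rewrite !count_map -!has_pred1 !has_count !(count_sum (predC _)).
rewrite !(count_sum (preim _ _)) !big_V6E.
rewrite !(mul0n, mul1n, add0n, addn0).
(* For [IDP] only presence matters; [TopD], [TopP], [ID] and [IP] are split into 0, 1 or several.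
   [Bot] has weight 0 in every count, so [b] stays whole. *)
move: (count_mem TopD S) (count_mem TopP S) (count_mem ID S) (count_mem IP S).
move: (count_mem IDP S) (count_mem Bot S).
by move=> [|a] b [|[|c]] [|[|e]] [|[|f]] [|[|g]]; rewrite ?(addSn, addnS).
Qed.
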